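(* Let $p\ge 2$, $k\ge 1$ and $N\ge 1$ be integers and let $R:((\mathbb{C}^N)^{\otimes p})^{\otimes k}\to\mathbb{C}$ be a linear form (equivalently, a form that is linear in each $(\mathbb{C}^N)^{\otimes p}$ component) which is $\mathfrak{S}_N$-invariant, i.e. $R(U\cdot T)=R(T)$ for every $N\times N$ permutation matrix $U$ and every $T\in((\mathbb{C}^N)^{\otimes p})^{\otimes k}$. Then $R$ is a linear combination of the trace forms $T\mapsto \mathrm{Tr}_{\mathfrak{h}}(T)$, where $\mathfrak{h}$ ranges over $p$-uniform test hypergraphs with $k$ hyperedges. Likewise, $R$ is a linear combination of the injective trace forms $T\mapsto \mathrm{Tr}^0_{\mathfrak{h}}(T)$, where $\mathfrak{h}$ ranges over $p$-uniform test hypergraphs with $k$ hyperedges.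
   Context: An element $T\in ((\mathbb{C}^N)^{\otimes p})^{\otimes k}=(\mathbb{C}^N)^{\otimes pk}$ is an array $(T_{i_1,\dots,i_{pk}})_{1\le i_1,\dots,i_{pk}\le N}$. A matrix $U$ of size $N$ acts by $(U\cdot T)_{i_1,\dots,i_{pk}}=\sum_{j_1,\dots,j_{pk}}T_{j_1,\dots,j_{pk}}\prod_{l=1}^{pk}U_{j_l i_l}$. Here a $p$-uniform test hypergraph with $k$ hyperedges is a pair $\mathfrak{h}=(V,E)$ with $V$ a finite vertex set and $E=(e_1,\dots,e_k)$ a list of $k$ hyperedges, each hyperedge $e_l=(v_{l,1},\dots,v_{l,p})$ being a $p$-tuple of (not necessarily distinct) elements of $V$; repeated hyperedges are allowed. For $T\in(\mathbb{C}^N)^{\otimes pk}$, $$\mathrm{Tr}_{\mathfrak{h}}(T)=\sum_{\phi:V\to[N]}T_{\phi(v_{1,1}),\dots,\phi(v_{1,p}),\dots,\phi(v_{k,1}),\dots,\phi(v_{k,p})},$$ and $\mathrm{Tr}^0_{\mathfrak{h}}(T)$ is the same sum restricted to injective maps $\phi$. In particular, for $T=T_1\otimes\cdots\otimes T_k$ with $T_l\in(\mathbb{C}^N)^{\otimes p}$, $\mathrm{Tr}_{\mathfrak{h}}(T)=\sum_{\phi:V\to[N]}\prod_{l=1}^k (T_l)_{\phi(v_{l,1}),\dots,\phi(v_{l,p})}$. *)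

(* Defs.v *)
From HB Require Import structures.
From mathcomp Require Import all_boot all_order all_algebra.
From mathcomp Require Import fingroup perm.
From mathcomp Require Import reals.
From mathcomp.real_closed Require Import complex.

Set Implicit Arguments.
Unset Strict Implicit.
Unset Printing Implicit Defensive.

Import Order.TTheory GRing.Theory Num.Theory.
Local Open Scope ring_scope.

(* The pk tensor slots are indexed by pairs (l, m): slot m of the l-th factor
   (K^N)^{(x) p}. *)
Definition multi_index (N p k : nat) := {ffun 'I_k * 'I_p -> 'I_N}.

Definition tensor (K : comNzRingType) (N p k : nat) :=
  {ffun multi_index N p k -> K^o}.

(* Transposed convention: the summation index j is the row index of U. *)
Definition mx_act (K : comNzRingType) (N p k : nat)
    (U : 'M[K]_N) (T : tensor K N p k) : tensor K N p k :=
  [ffun i : multi_index N p k =>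
     \sum_(j : multi_index N p k) T j * \prod_(s : 'I_k * 'I_p) U (j s) (i s)].

Definition perm_invariant (K : comNzRingType) (N p k : nat)
    (F : tensor K N p k -> K) : Prop :=
  forall (U : 'M[K]_N) (T : tensor K N p k), is_perm_mx U -> F (mx_act U T) = F T.

Record test_hypergraph (p k : nat) := TestHypergraph {
  vertex : finType;
  edges : k.-tuple (p.-tuple vertex)
}.

Definition edge_index (N p k : nat) (h : test_hypergraph p k)
    (phi : {ffun vertex h -> 'I_N}) : multi_index N p k :=
  [ffun s : 'I_k * 'I_p => phi (tnth (tnth (edges h) s.1) s.2)].

Definition Tr (K : comNzRingType) (N p k : nat) (h : test_hypergraph p k)
    (T : tensor K N p k) : K :=
  \sum_(phi : {ffun vertex h -> 'I_N}) T (edge_index phi).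

Definition Tr0 (K : comNzRingType) (N p k : nat) (h : test_hypergraph p k)
    (T : tensor K N p k) : K :=
  \sum_(phi : {ffun vertex h -> 'I_N} | injectiveb phi) T (edge_index phi).

Definition lin_comb (K : comNzRingType) (A X : Type) (G : A -> X -> K)
    (F : X -> K) : Prop :=
  exists (n : nat) (a : 'I_n -> A) (c : 'I_n -> K),
    forall x : X, F x = \sum_(i < n) c i * G (a i) x.

(* Main.v *)
(** Averaging an invariant form [F] over the symmetric group gives
    [N! F(T) = \sum_i F(e_i) \sum_s T_(s o i)], and the inner sum is the injective
    trace form of the hypergraph with vertex set [N] whose edges are read off the
    multi-index [i]: the injective labellings are then exactly the permutations, at
    the cost of isolated vertices.  To pass to the plain trace forms, impose the
    constraints [phi u != phi v] one at a time: the labellings violating such a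
    constraint are the labellings of the hypergraph in which [u] and [v] are merged. *)
Require Import Defs.
From HB Require Import structures.
From mathcomp Require Import all_boot all_order all_algebra.
From mathcomp Require Import fingroup perm.
From mathcomp Require Import reals.
From mathcomp.real_closed Require Import complex.
Local Open Scope ring_scope.

Set Implicit Arguments.
Unset Strict Implicit.
Unset Printing Implicit Defensive.

Import GRing.Theory Num.Theory.

Section LinComb.
Variables (K : comNzRingType) (A X : Type) (G : A -> X -> K).

Lemma eq_lin_comb (F1 F2 : X -> K) :
  F1 =1 F2 -> lin_comb G F1 -> lin_comb G F2.
Proof.
by move=> eqF [n [a [c F1E]]]; exists n, a, c => x; rewrite -eqF.
Qed.

Lemma lin_comb0 : lin_comb G (fun=> 0).
Proof.
(* [A] may be empty, so the empty family of generators is a map out of ['I_0]. *)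
have a : 'I_0 -> A by case.
by exists 0, a, (fun=> 0) => x; rewrite big_ord0.
Qed.

Lemma lin_comb_gen (a : A) : lin_comb G (G a).
Proof. by exists 1, (fun=> a), (fun=> 1) => x; rewrite big_ord1 mul1r. Qed.

Lemma lin_combD (F1 F2 : X -> K) :
  lin_comb G F1 -> lin_comb G F2 -> lin_comb G (fun x => F1 x + F2 x).
Proof.
move=> [n1 [a1 [c1 F1E]]] [n2 [a2 [c2 F2E]]].
pose glue B (f1 : 'I_n1 -> B) (f2 : 'I_n2 -> B) (i : 'I_(n1 + n2)) :=
  match split i with inl j => f1 j | inr j => f2 j end.
exists (n1 + n2)%N, (glue _ a1 a2), (glue _ c1 c2) => x.
rewrite F1E F2E big_split_ord; congr (_ + _); apply: eq_bigr => i _.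
  by rewrite /glue (unsplitK (inl i)).
by rewrite /glue (unsplitK (inr i)).
Qed.

Lemma lin_combZ (b : K) (F : X -> K) :
  lin_comb G F -> lin_comb G (fun x => b * F x).
Proof.
move=> [n [a [c FE]]]; exists n, a, (fun i => b * c i) => x.
by rewrite FE mulr_sumr; apply: eq_bigr => i _; rewrite mulrA.
Qed.

Lemma lin_comb_sum (I : Type) (r : seq I) (F : I -> X -> K) :
  (forall i, lin_comb G (F i)) -> lin_comb G (fun x => \sum_(i <- r) F i x).
Proof.
move=> FG; elim: r => [|i r IHr].
  by apply: eq_lin_comb lin_comb0 => x; rewrite big_nil.
by apply: eq_lin_comb (lin_combD (FG i) IHr) => x; rewrite big_cons.
Qed.

End LinComb.

Lemma lin_comb_trans (K : comNzRingType) (A B X : Type)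
    (G : A -> X -> K) (H : B -> X -> K) (F : X -> K) :
  (forall a, lin_comb H (G a)) -> lin_comb G F -> lin_comb H F.
Proof.
move=> GH [n [a [c FE]]]; apply: eq_lin_comb (fun x => esym (FE x)) _.
by apply: lin_comb_sum => i; apply: lin_combZ.
Qed.

Section MergeVertices.
Variables (p k : nat) (h : test_hypergraph p k) (u v : vertex h).
Hypothesis neq_uv : u != v.

(** The default value of [insubd] does the merging: [v] is the only vertex outside the subtype, so
    it alone is sent to [u]. *)
Definition merge_vertex (x : vertex h) : {y : vertex h | y != v} :=
  insubd (exist (fun y : vertex h => y != v) u neq_uv) x.

Lemma val_merge_vertex (x : vertex h) :
  val (merge_vertex x) = if x == v then u else x.
Proof. by rewrite /merge_vertex val_insubd; case: (x == v). Qed.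

Definition merged : test_hypergraph p k :=
  @TestHypergraph p k {y : vertex h | y != v}
    (map_tuple (map_tuple merge_vertex) (edges h)).

(** Labellings with [phi u = phi v] are exactly those that factor through [merge_vertex]. The other
    constraints [L] are carried along so that merging can be iterated. *)
Lemma sum_merged (K : comNzRingType) (N : nat) (T : tensor K N p k)
    (L : seq (vertex h * vertex h)) :
  \sum_(phi : {ffun vertex h -> 'I_N} |
        all (fun e => phi e.1 != phi e.2) L && (phi u == phi v))
    T (edge_index phi)
  = \sum_(phi : {ffun vertex merged -> 'I_N} |
          all (fun e => phi e.1 != phi e.2)
              [seq (merge_vertex e.1, merge_vertex e.2) | e <- L])
      T (edge_index phi).
Proof.
pose lift_label (phi : {ffun vertex merged -> 'I_N}) : {ffun vertex h -> 'I_N} :=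
  [ffun x => phi (merge_vertex x)].
pose restrict_label (phi : {ffun vertex h -> 'I_N}) : {ffun vertex merged -> 'I_N} :=
  [ffun y => phi (val y)].
rewrite (reindex_onto lift_label restrict_label) /=; last first.
  move=> phi /andP[_ /eqP phi_uv]; apply/ffunP => x.
  by rewrite !ffunE val_merge_vertex; case: eqP => // ->.
apply: eq_big => [phi|phi _].
  have -> : restrict_label (lift_label phi) == phi.
    apply/eqP/ffunP => y; rewrite !ffunE; congr (phi _); apply: val_inj.
    by rewrite val_merge_vertex (negPf (valP y)).
  have -> : lift_label phi u == lift_label phi v.
    rewrite !ffunE; apply/eqP; congr (phi _); apply: val_inj.
    by rewrite !val_merge_vertex eqxx (negPf neq_uv).
  by rewrite !andbT all_map; apply: eq_all => e; rewrite /= !ffunE.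
by congr (T _); apply/ffunP => s; rewrite !ffunE !tnth_map.
Qed.

End MergeVertices.

Lemma constrained_lin_comb_Tr (K : comNzRingType) (N p k : nat)
    (h : test_hypergraph p k) (L : seq (vertex h * vertex h)) :
  lin_comb (@Tr K N p k)
    (fun T => \sum_(phi : {ffun vertex h -> 'I_N} |
                    all (fun e => phi e.1 != phi e.2) L) T (edge_index phi)).
Proof.
(* Induction on the length of [L], with [h] generalized: merging changes the hypergraph, and with it
   the type of the constraints. *)
have [n] := ubnP (size L); elim: n => // n IHn in h L *.
case: L => [_|[u v] L /= ltLn]; first exact: (lin_comb_gen _ h).
(* Earlier merging may have identified the two ends of a constraint; no labelling then satisfies it
   and the sum is empty. *)
have [<-{v}|neq_uv] := eqVneq u v.
  apply: eq_lin_comb (lin_comb0 _) => T.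
  by rewrite big_pred0 // => phi; rewrite eqxx.
have merged_comb := IHn (merged neq_uv)
  [seq (merge_vertex neq_uv e.1, merge_vertex neq_uv e.2) | e <- L].
rewrite size_map in merged_comb.
(* Drop the constraint [phi u != phi v], then subtract the labellings that violate it. *)
apply: eq_lin_comb (lin_combD (IHn _ L ltLn) (lin_combZ (-1) (merged_comb ltLn))).
move=> T /=; rewrite -sum_merged mulN1r.
rewrite (bigID (fun phi : {ffun vertex h -> 'I_N} => phi u == phi v)) /=.
by rewrite addrAC subrr add0r; apply: eq_bigl => phi; rewrite andbC.
Qed.

Lemma Tr0_lin_comb_Tr (K : comNzRingType) (N p k : nat) (h : test_hypergraph p k) :
  lin_comb (@Tr K N p k) (@Tr0 K N p k h).
Proof.
(* Injectivity is the conjunction of the constraints over all pairs of distinct vertices. *)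
apply: eq_lin_comb (constrained_lin_comb_Tr K N
  [seq e <- enum {: vertex h * vertex h} | e.1 != e.2]) => T.
apply: eq_bigl => phi; apply/allP/injectiveP => [phi_neq x y eq_phi|phi_inj e].
  apply/eqP; apply: contraT => neq_xy.
  by have := phi_neq (x, y); rewrite mem_filter neq_xy mem_enum eq_phi eqxx => /(_ isT).
by rewrite mem_filter inj_eq // => /andP[].
Qed.

Definition index_hypergraph (N p k : nat) (i : multi_index N p k) :
    test_hypergraph p k :=
  @TestHypergraph p k 'I_N [tuple [tuple i (l, m) | m < p] | l < k].

(** The entry of [perm_mx s] at [(a, b)] is 1 if [s a = b] and 0 otherwise, so only the multi-index
    [j] with [s (j x) = i x] at every slot contributes. *)
Lemma mx_act_perm (K : comNzRingType) (N p k : nat) (s : 'S_N)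
    (T : tensor K N p k) (i : multi_index N p k) :
  mx_act (perm_mx s) T i = T [ffun x => (s^-1)%g (i x)].
Proof.
rewrite ffunE (bigD1 [ffun x => (s^-1)%g (i x)]) //= big1 ?mulr1 => [|x _].
  rewrite big1 ?addr0 // => j; apply: contraNeq => nz_prod.
  apply/eqP/ffunP => x; rewrite ffunE; apply: (canRL (permK s)); apply/eqP.
  apply: contraNT nz_prod => neq_x.
  by rewrite (bigD1 x) //= !mxE (negPf neq_x) mul0r mulr0.
by rewrite !mxE ffunE permKV eqxx.
Qed.

Lemma sum_mx_act_perm (K : comNzRingType) (N p k : nat)
    (T : tensor K N p k) (i : multi_index N p k) :
  \sum_(s : 'S_N) mx_act (perm_mx s) T i = Tr0 (index_hypergraph i) T.
Proof.
(* Inverting [s] cancels the inverse produced by the action. Permutations then correspond to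
   injective labellings of ['I_N]; the default [1] of [insubd] is never reached on these. *)
rewrite (reindex_inj invg_inj) /Tr0 /=.
rewrite (reindex_onto (fun s : 'S_N => [ffun x => s x]) (insubd (1%g : 'S_N))) /=.
  apply: eq_big => [s|s _].
    have inj_s : injectiveb [ffun x => s x].
      by apply/injectiveP => x y; rewrite !ffunE => /perm_inj.
    rewrite inj_s; apply/esym/eqP/permP => x.
    by rewrite -pvalE val_insubd inj_s ffunE.
  rewrite mx_act_perm invgK; congr (T _); apply/ffunP => -[l m].
  by rewrite !ffunE !tnth_mktuple.
move=> phi inj_phi; apply/ffunP => x.
by rewrite ffunE -pvalE val_insubd inj_phi.
Qed.

Lemma perm_invariant_lin_comb_Tr0 (K : fieldType) (p k N : nat)
    (F : {scalar (tensor K N p k)}) :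
  N`!%:R != 0 :> K -> perm_invariant F -> lin_comb (@Tr0 K N p k) F.
Proof.
move=> nzN invF.
pose e (i : multi_index N p k) : tensor K N p k := [ffun j => (j == i)%:R].
have decomp (T : tensor K N p k) : T = \sum_i T i *: e i.
  apply/ffunP => j; rewrite sum_ffunE (bigD1 j) //= !ffunE eqxx.
  rewrite big1 ?addr0 => [|i neq_ij]; first by rewrite [RHS]mulr1.
  by rewrite !ffunE eq_sym (negPf neq_ij) scaler0.
have avg T : F T = \sum_i N`!%:R^-1 * F (e i) * Tr0 (index_hypergraph i) T.
  (* By invariance each of the [N!] summands contributes [F T]. *)
  have -> : F T = N`!%:R^-1 * F (\sum_(s : 'S_N) mx_act (perm_mx s) T).
    rewrite raddf_sum (eq_bigr (fun=> F T)) => [|s _].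
      by rewrite sumr_const card_Sn -[F T *+ _]mulr_natl mulKf.
    by apply: invF; apply: perm_mx_is_perm.
  (* Only the averaged tensor is expanded in the basis [e]: its coordinate at [i] is the injective
     trace of [index_hypergraph i]. *)
  rewrite [in LHS](decomp (\sum_s _)) raddf_sum mulr_sumr; apply: eq_bigr => i _.
  by rewrite [X in _ * X]linearZ /= sum_ffunE sum_mx_act_perm mulrCA mulrC.
apply: eq_lin_comb (fun T => esym (avg T)) _.
by apply: lin_comb_sum => i; apply/lin_combZ/lin_comb_gen.
Qed.

Unset Implicit Arguments.

Theorem theorem1p1 (R : realType) (p k N : nat)
  (hp : (2 <= p)%N) (hk : (1 <= k)%N) (hN : (1 <= N)%N)
  (F : {scalar (tensor (complex R) N p k)})
  (hF : perm_invariant F) :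
  lin_comb (fun (h : test_hypergraph p k) (T : tensor (complex R) N p k) => Tr h T) F
  /\ lin_comb (fun (h : test_hypergraph p k) (T : tensor (complex R) N p k) => Tr0 h T) F.
Proof.
have Tr0F : lin_comb (@Tr0 (complex R) N p k) F.
  (* Characteristic zero makes [N!] invertible. *)
  by apply: perm_invariant_lin_comb_Tr0 hF; rewrite pnatr_eq0 -lt0n fact_gt0.
by split=> //; apply: lin_comb_trans Tr0F => h; apply: Tr0_lin_comb_Tr.
Qed.
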